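(* Let $0<\varepsilon<1/2$ and $b\ge 2$. Let $\mathbb{F}$ be a field and $\mathcal{F}$ a family of square matrices over $\mathbb{F}$ such that for every $d\times d$ matrix $A\in\mathcal{F}$ either $d\le b$, or $R^{rc}_{\mathbb{F}}(A,d^{1-\gamma})\le d^{\varepsilon}$ for $\gamma=\dfrac{12(\log\log d)^2}{\varepsilon^3\log d}$. Then, for every sequence of matrices $M_1,\dots,M_k\in\mathcal{F}$, the $n\times n$ matrix $M=\bigotimes_{i\in[k]}M_i$ either satisfies $R^{rc}_{\mathbb{F}}(M,n/\log n)\le n^{6\varepsilon}$, or $n$ is bounded above by a function of $b$ and $\varepsilon$.
   Context: For $A\in\mathbb{F}^{n\times n}$ and a target rank $r$, the row-column rigidity $R^{rc}_{\mathbb{F}}(A,r)$ is the minimal $t$ for which there exists $Z\in\mathbb{F}^{n\times n}$ with $\operatorname{rank}(A-Z)\le r$ such that every row and every column of $Z$ has at most $t$ non-zero entries. $\bigotimes$ denotes the Kronecker product. *)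

(* Defs.v *)
From HB Require Import structures.
From mathcomp Require Export all_boot all_order all_algebra.
From mathcomp Require Export boolp reals exp.
From mathcomp Require Export mxtens.

Set Implicit Arguments.
Unset Strict Implicit.
Unset Printing Implicit Defensive.

Import Order.TTheory GRing.Theory Num.Theory.
Local Open Scope ring_scope.

Definition rc_sparse (F : fieldType) (n t : nat) (Z : 'M[F]_n) : Prop :=
  (forall i, (#|[pred j | Z i j != 0%R]| <= t)%N) /\
  (forall j, (#|[pred i | Z i j != 0%R]| <= t)%N).

Definition rc_rigid_le (F : fieldType) (n : nat) (A : 'M[F]_n) (r : nat) :
    pred nat :=
  fun t => `[< exists Z : 'M[F]_n, (\rank (A - Z)%R <= r)%N /\ rc_sparse t Z >].

Lemma rc_rigid_le_ex (F : fieldType) (n : nat) (A : 'M[F]_n) (r : nat) :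
  exists t, rc_rigid_le A r t.
Proof.
exists n; apply/asboolP; exists A; rewrite subrr mxrank0; split=> //.
by split=> i; rewrite (leq_trans (max_card _)) ?card_ord.
Qed.

(* For a real target rank x >= 0, use r = Num.truncn x = floor x: ranks being
   integers, rank <= x iff rank <= floor x (Num.Theory.truncn_ge_nat). *)
Definition rc_rigidity (F : fieldType) (n : nat) (A : 'M[F]_n) (r : nat) : nat :=
  ex_minn (rc_rigid_le_ex A r).

Definition sqmx (F : fieldType) := {d : nat & 'M[F]_d}.

Definition kron (F : fieldType) (A B : sqmx F) : sqmx F :=
  Tagged (fun d => 'M[F]_d) (tagged A *t tagged B).

Definition kron1 (F : fieldType) : sqmx F :=
  Tagged (fun d => 'M[F]_d) (1%:M : 'M[F]_1).

(* The logarithm to base a; the source leaves the base of its logarithms implicit. *)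
Definition logb (R : realType) (a x : R) : R := ln x / ln a.

Definition rig_gamma (R : realType) (a eps : R) (d : nat) : R :=
  12 * (logb a (logb a d%:R)) ^+ 2 / (eps ^+ 3 * logb a d%:R).

(* Main.v *)
(* A matrix is called nonrigid with parameters (rho, s) if it is the sum of a
   matrix of rank at most rho n and one with at most s nonzero entries in each
   row and column.  Multiplying two n x n matrices adds the rho's and multiplies
   the s's, so it suffices to treat separately, for each class of factors, the
   Kronecker product in which all other factors are replaced by identities.

   The factors of bounded dimension form one class, and the others are grouped
   by [j = floor (log2 (floor (log2 d)))].  A class of total dimension at most
   n^(eps / (J + 1)), J being the value of this function at n, is kept as a
   dense matrix.  In any other class:
   - If d is unbounded, each factor is L + S with L of relative rank
     exp (- c j^2) and S sparse; expand the product and put in the sparse part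
     the terms with at most eps k / 2 factors L, where k is the size of the class.
   - If d is bounded, write each factor as P L U.  A nonzero entry (x, y) of a
     Kronecker product of upper triangular matrices satisfies x_i <= y_i for
     all i, while the sum of the coordinates is concentrated around its mean, so
     outside an exponentially small proportion of rows and columns x and y
     differ in few coordinates.
   In both cases the relative rank is much smaller than 1 / (2^J (J + 1)), and
   2^J has the order of log n. *)
Require Import Defs.
From mathcomp Require Import perm sequences exp ring lra.

Set Implicit Arguments.
Unset Strict Implicit.
Unset Printing Implicit Defensive.

Import Order.TTheory GRing.Theory Num.Theory.
Local Open Scope ring_scope.

(** * Sparse matrices and nonrigidity *)

Section Sparsity.
Context {R : realType} {F : fieldType}.

(** The bound is real because it will be a product of real powers of dimensions; a sum of indicators
    makes the count multiplicative under [*m] and [*t]. *)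
Definition row_sparse m n (s : R) (Z : 'M[F]_(m, n)) :=
  forall i, \sum_j (Z i j != 0)%:R <= s.

Definition sparse n (s : R) (Z : 'M[F]_n) := row_sparse s Z /\ row_sparse s Z^T.

Lemma row_sparse_add m n s1 s2 (A B : 'M[F]_(m, n)) :
  row_sparse s1 A -> row_sparse s2 B -> row_sparse (s1 + s2) (A + B).
Proof.
move=> hA hB i; apply: le_trans (lerD (hA i) (hB i)).
rewrite -big_split /=; apply: ler_sum => j _; rewrite !mxE -natrD ler_nat.
have [->|_] := eqVneq (A i j) 0; first by rewrite add0r.
by rewrite (leq_trans (leq_b1 _)).
Qed.

Lemma row_sparse_mul m n p s1 s2 (A : 'M[F]_(m, n)) (B : 'M[F]_(n, p)) :
  0 <= s2 -> row_sparse s1 A -> row_sparse s2 B ->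
  row_sparse (s1 * s2) (A *m B).
Proof.
move=> s2_ge0 hA hB i.
have h j : ((A *m B) i j != 0)%:R <=
    \sum_k (A i k != 0)%:R * (B k j != 0)%:R :> R.
  case: eqP => [_|/eqP]; first by apply: sumr_ge0 => k _; rewrite -natrM ler0n.
  rewrite mxE => nz; have [k hk] : exists k, A i k * B k j != 0.
    apply/existsP; apply: contraR nz; rewrite negb_exists => /forallP h.
    by rewrite big1 // => k _; apply/eqP; have := h k; rewrite negbK.
  move: hk; rewrite mulf_eq0 negb_or => /andP[nA nB].
  rewrite (bigD1 k) //= nA nB mulr1 lerDl.
  by apply: sumr_ge0 => k' _; rewrite -natrM ler0n.
apply: (le_trans (ler_sum _ (fun j _ => h j))); rewrite exchange_big /=.
apply: (@le_trans _ _ (\sum_k (A i k != 0)%:R * s2)).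
  apply: ler_sum => k _; rewrite -mulr_sumr; apply: ler_wpM2l; first exact: ler0n.
  exact: hB.
by rewrite -mulr_suml; apply: ler_wpM2r => //; exact: hA.
Qed.

Lemma row_sparse_tens m n p q s1 s2 (A : 'M[F]_(m, n)) (B : 'M[F]_(p, q)) :
  row_sparse s1 A -> row_sparse s2 B -> row_sparse (s1 * s2) (A *t B).
Proof.
move=> hA hB i; case: (mxtens_indexP i) => x y.
under eq_bigr => j _ do
  rewrite !mxE !mxtens_indexK /= mulf_eq0 negb_or -mulnb natrM.
rewrite -(mulr_sum (fun j => (A x j != 0)%:R) (fun j => (B y j != 0)%:R)).
apply: ler_pM; [| |exact: hA|exact: hB]; apply: sumr_ge0 => k _; exact: ler0n.
Qed.

Lemma row_sparse_le m n s1 s2 (A : 'M[F]_(m, n)) :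
  s1 <= s2 -> row_sparse s1 A -> row_sparse s2 A.
Proof. by move=> h hA i; apply: le_trans h. Qed.

Lemma row_sparse_full m n (A : 'M[F]_(m, n)) : row_sparse n%:R A.
Proof.
move=> i; rewrite -[X in _ <= X%:R](card_ord n) -sum1_card natr_sum.
by apply: ler_sum => j _; rewrite lern1; case: (_ != _).
Qed.

Lemma sparse_ge0 n s (A : 'M[F]_n) : sparse s A -> (0 < n)%N -> 0 <= s.
Proof.
move=> [hA _] n_gt0; apply: le_trans (hA (Ordinal n_gt0)).
by apply: sumr_ge0 => j _; exact: ler0n.
Qed.

Lemma sparse_tr n s (A : 'M[F]_n) : sparse s A -> sparse s A^T.
Proof. by case=> hA hAT; split; rewrite ?trmxK. Qed.

Lemma sparse_add n s1 s2 (A B : 'M[F]_n) :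
  sparse s1 A -> sparse s2 B -> sparse (s1 + s2) (A + B).
Proof.
by case=> hA hA' [hB hB']; split; rewrite ?linearD /=; apply: row_sparse_add.
Qed.

Lemma sparse_mul n s1 s2 (A B : 'M[F]_n) :
  sparse s1 A -> sparse s2 B -> sparse (s1 * s2) (A *m B).
Proof.
case: n A B => [|n] A B hA hB; first by split=> -[].
have s1_ge0 := sparse_ge0 hA isT; have s2_ge0 := sparse_ge0 hB isT.
case: hA hB => [hA hA'] [hB hB'].
split; rewrite ?trmx_mul 1?[s1 * s2]mulrC; last exact: row_sparse_mul.
by rewrite mulrC; apply: row_sparse_mul.
Qed.

Lemma sparse_tens m n s1 s2 (A : 'M[F]_m) (B : 'M[F]_n) :
  sparse s1 A -> sparse s2 B -> sparse (s1 * s2) (A *t B).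
Proof.
by case=> hA hA' [hB hB']; split; rewrite ?trmx_tens; apply: row_sparse_tens.
Qed.

Lemma sparse_le n s1 s2 (A : 'M[F]_n) : s1 <= s2 -> sparse s1 A -> sparse s2 A.
Proof. by move=> h [hA hA']; split; apply: row_sparse_le h _. Qed.

Lemma sparse_full n (A : 'M[F]_n) : sparse n%:R A.
Proof. by split; apply: row_sparse_full. Qed.

Lemma sparse_perm n (p : 'S_n) : sparse 1 (perm_mx p : 'M[F]_n).
Proof.
have h (q : 'S_n) : row_sparse 1 (perm_mx q : 'M[F]_n).
  move=> i; rewrite (bigD1 (q i)) //= big1 ?addr0.
    by rewrite lern1; case: (_ != _).
  by move=> j /negPf nj; rewrite !mxE [q i == j]eq_sym nj eqxx.
by split; rewrite ?tr_perm_mx.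
Qed.

Lemma sparse1 n : sparse 1 (1%:M : 'M[F]_n).
Proof. by rewrite -perm_mx1; apply: sparse_perm. Qed.

(** Tensoring rank factorisations of [A] and [B] makes [A *t B] factor through dimension
    [\rank A * \rank B]. *)
Lemma mxrank_tens_le m n p q (A : 'M[F]_(m, n)) (B : 'M[F]_(p, q)) :
  (\rank (A *t B) <= \rank A * \rank B)%N.
Proof.
rewrite -{1}(mulmx_base A) -{1}(mulmx_base B) -tensmx_mul.
exact: leq_trans (mxrankM_maxl _ _) (rank_leq_col _).
Qed.

Lemma mxrank_nz_rows m n (A : 'M[F]_(m, n)) (P : pred 'I_m) :
  (forall i, ~~ P i -> row i A = 0) -> (\rank A <= #|P|)%N.
Proof.
move=> hP.
have -> : A = \sum_(i | P i) delta_mx i 0 *m row i A.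
  apply/matrixP => x y; rewrite summxE; have [Px|nPx] := boolP (P x).
    rewrite (bigD1 x) //= big1 ?addr0 => [|i /andP[_ /negPf ne]].
      by rewrite mxE big_ord1 !mxE !eqxx mul1r.
    by rewrite mxE big_ord1 !mxE eq_sym ne mul0r.
  have /rowP/(_ y) := hP x nPx; rewrite !mxE => ->; rewrite big1 // => i Pi.
  rewrite mxE big_ord1 !mxE; case: eqP => [e|]; last by rewrite mul0r.
  by move: nPx; rewrite e Pi.
rewrite -sum1_card; elim/big_ind2: _ => [|B a C b hB hC|i _].
- by rewrite mxrank0.
- exact: leq_trans (mxrank_add _ _) (leq_add hB hC).
- exact: leq_trans (mxrankM_maxl _ _) (rank_leq_col _).
Qed.

Definition nonrigid n (A : 'M[F]_n) (rho s : R) :=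
  exists2 Z : 'M[F]_n, (\rank (A - Z))%:R <= rho * n%:R & sparse s Z.

Lemma nonrigid_sparse n (A : 'M[F]_n) s : sparse s A -> nonrigid A 0 s.
Proof. by move=> hA; exists A => //; rewrite subrr mxrank0 mul0r. Qed.

Lemma nonrigid_le n (A : 'M[F]_n) rho1 s1 rho2 s2 :
  rho1 <= rho2 -> s1 <= s2 -> nonrigid A rho1 s1 -> nonrigid A rho2 s2.
Proof.
move=> hr hs [Z hZ hsZ]; exists Z; last exact: sparse_le hs hsZ.
by apply: le_trans hZ _; rewrite ler_wpM2r.
Qed.

Lemma nonrigid_tr n (A : 'M[F]_n) rho s : nonrigid A rho s -> nonrigid A^T rho s.
Proof.
case=> Z hZ hsZ; exists Z^T; last exact: sparse_tr.
by rewrite -linearB /= mxrank_tr.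
Qed.

Lemma nonrigid_mul n (A B : 'M[F]_n) rho1 s1 rho2 s2 :
  nonrigid A rho1 s1 -> nonrigid B rho2 s2 ->
  nonrigid (A *m B) (rho1 + rho2) (s1 * s2).
Proof.
case=> Z hZ hsZ [Y hY hsY]; exists (Z *m Y); last exact: sparse_mul.
have -> : A *m B - Z *m Y = (A - Z) *m B + Z *m (B - Y).
  by rewrite mulmxBl mulmxBr addrA subrK.
rewrite mulrDl; apply: le_trans (lerD hZ hY); rewrite -natrD ler_nat.
apply: leq_trans (mxrank_add _ _) (leq_add _ _); first exact: mxrankM_maxl.
exact: mxrankM_maxr.
Qed.

(** Truncating [x] and [s] loses nothing, as ranks and numbers of nonzero entries are integers. *)
Lemma rc_rigidity_le n (A : 'M[F]_n) (x s : R) :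
  (exists2 Z : 'M[F]_n, (\rank (A - Z))%:R <= x & sparse s Z) -> 0 <= s ->
  (rc_rigidity A (Num.truncn x))%:R <= s.
Proof.
case=> Z hr [hZ hZ'] s_ge0; rewrite /rc_rigidity; case: ex_minnP => m _ hm.
have x_ge0 : 0 <= x by apply: le_trans hr.
have cnt p q (B : 'M[F]_(p, q)) i : row_sparse s B ->
    (#|[pred j | B i j != 0%R]| <= Num.truncn s)%N.
  move=> /(_ i) hB; rewrite truncn_ge_nat // -sum1_card natr_sum.
  apply: le_trans hB; rewrite [leLHS]big_mkcond /=; apply: ler_sum => j _.
  by rewrite inE; case: (B i j != 0).
suff /hm h : rc_rigid_le A (Num.truncn x) (Num.truncn s).
  by rewrite -truncn_ge_nat.
apply/asboolP; exists Z; split; first by rewrite truncn_ge_nat.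
split=> i; first exact: cnt.
rewrite (leq_trans _ (cnt _ _ _ i hZ')) //; apply: eq_leq; apply: eq_card => j.
by rewrite !inE mxE.
Qed.

Lemma rc_rigidityP n (A : 'M[F]_n) (x s : R) :
  0 <= x -> (rc_rigidity A (Num.truncn x))%:R <= s ->
  exists2 Z : 'M[F]_n, (\rank (A - Z))%:R <= x & sparse s Z.
Proof.
move=> x_ge0; rewrite /rc_rigidity; case: ex_minnP => m.
case/asboolP=> Z [hr [hZ hZ']] _ hs; exists Z.
  by rewrite -truncn_ge_nat.
by split=> i; apply: le_trans hs; rewrite -natr_sum ler_nat;
  [apply: leq_trans (hZ i)|apply: leq_trans (hZ' i)];
  rewrite -sum1_card [leqRHS]big_mkcond /=; apply: leq_sum => j _;
  rewrite inE ?mxE; case: (Z _ _ != 0).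
Qed.

End Sparsity.

(** * Kronecker products over lists *)

Section KroneckerLists.
Context {R : realType} {F : fieldType}.
Implicit Types (A : sqmx F) (s : seq (sqmx F)).

Fixpoint kron_dim s : nat := if s is A :: s' then (tag A * kron_dim s')%N else 1.

(** Letting [g] vary with [s] fixed keeps all products at one size, so that they can be multiplied
    and the mixed-product rule applies. *)
Fixpoint kron_map (g : forall A, 'M[F]_(tag A)) s : 'M[F]_(kron_dim s) :=
  if s is A :: s' then g A *t kron_map g s' else 1%:M.

Lemma big_kronE k (Ms : 'I_k -> sqmx F) :
  \big[@kron F/kron1 F]_(i < k) Ms i =
  Tagged (fun d => 'M[F]_d) (kron_map (fun A => tagged A) [seq Ms i | i <- enum 'I_k]).
Proof.
rewrite -(big_map Ms xpredT id) /index_enum -enumT.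
elim: [seq Ms i | i <- enum 'I_k] => [|A s IHs]; first by rewrite big_nil.
by rewrite big_cons IHs.
Qed.

Lemma kron_map_mul g h s :
  kron_map g s *m kron_map h s = kron_map (fun A => g A *m h A) s.
Proof.
by elim: s => [|A s IHs] /=; rewrite ?mulmx1 // tensmx_mul IHs.
Qed.

Lemma kron_map_tr g s : (kron_map g s)^T = kron_map (fun A => (g A)^T) s.
Proof. by elim: s => [|A s IHs] /=; rewrite ?trmx1 // trmx_tens IHs. Qed.

Lemma eq_kron_map g h s : (forall A, A \in s -> g A = h A) -> kron_map g s = kron_map h s.
Proof.
elim: s => [//|A s IHs] gh /=; rewrite gh ?mem_head // IHs // => B Bs.
by rewrite gh // in_cons Bs orbT.
Qed.

Lemma sparse_kron_map (sigma : sqmx F -> R) g s :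
  (forall A, sparse (sigma A) (g A)) ->
  sparse (\prod_(A <- s) sigma A) (kron_map g s).
Proof.
move=> hg; elim: s => [|A s IHs] /=; rewrite ?big_nil ?big_cons.
  exact: sparse1.
exact: sparse_tens.
Qed.

Lemma tensmxDl m n p q (A B : 'M[F]_(m, n)) (C : 'M[F]_(p, q)) :
  (A + B) *t C = A *t C + B *t C.
Proof. by apply/matrixP=> i j; rewrite !mxE mulrDl. Qed.

Lemma tensmxBr m n p q (A : 'M[F]_(m, n)) (B C : 'M[F]_(p, q)) :
  A *t (B - C) = A *t B - A *t C.
Proof. by apply/matrixP=> i j; rewrite !mxE mulrBr. Qed.

Lemma mxrank_tens_ler m n (A : 'M[F]_m) (B : 'M[F]_n) (x y : R) :
  (\rank A)%:R <= x -> (\rank B)%:R <= y -> (\rank (A *t B))%:R <= x * y.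
Proof.
move=> hx hy; apply: le_trans (ler_pM _ _ hx hy); rewrite ?ler0n // -natrM ler_nat.
exact: mxrank_tens_le.
Qed.

Lemma mxrank_add_ler m n (A B : 'M[F]_(m, n)) (x y : R) :
  (\rank A)%:R <= x -> (\rank B)%:R <= y -> (\rank (A + B)%R)%:R <= x + y.
Proof.
move=> hx hy; apply: le_trans (lerD hx hy); rewrite -natrD ler_nat.
exact: mxrank_add.
Qed.

(* Expand the Kronecker product of the [L A + S A] and keep in the sparse part
   the terms with at most [t] factors [L A]. *)
Lemma nonrigid_kron_expand (P : pred (sqmx F)) (g : forall A, 'M[F]_(tag A))
    (rho D : R) (sigma : sqmx F -> R) s t :
  0 <= rho -> 1 <= D ->
  (forall A, ~~ P A -> g A = 1%:M) ->
  (forall A, P A -> nonrigid (g A) rho (sigma A)) ->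
  (forall A, P A -> (tag A)%:R <= D /\ 1 <= sigma A) ->
  nonrigid (kron_map g s)
    (2 ^+ count P s * rho ^+ t.+1)
    (2 ^+ count P s * (\prod_(A <- s | P A) sigma A) * D ^+ t).
Proof.
move=> rho_ge0 D_ge1 g1 gP sz; have D_ge0 : 0 <= D by lra.
elim: s t => [|A s IHs] t /=.
  rewrite big_nil !expr0 !mul1r; exists 1%:M.
    by rewrite subrr mxrank0 mulr1 exprn_ge0.
  by apply: sparse_le (sparse1 _); rewrite exprn_ege1.
have rank1 (B : 'M[F]_(tag A)) : (\rank B)%:R <= (tag A)%:R :> R.
  by rewrite ler_nat rank_leq_row.
rewrite big_cons; case: ifPn => [PA|nPA]; last first.
  rewrite g1 // add0n; have [E rE sE] := IHs t.
  exists (1%:M *t E); last by rewrite -[X in sparse X]mul1r; apply: sparse_tens (sparse1 _) _.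
  by rewrite -tensmxBr natrM mulrCA; apply: mxrank_tens_ler.
have [S rL sS] := gP _ PA; have [dD s1] := sz _ PA.
set L := g A - S in rL; have gE : g A = L + S by rewrite subrK.
rewrite add1n exprS; set c := 2 ^+ count P s in IHs *.
have c_ge1 : 1 <= c by rewrite exprn_ege1 // ler1n.
have p_ge1 : 1 <= \prod_(A <- s | P A) sigma A.
  elim/big_ind: _ => // [x y x1 y1|B /sz[]//].
  by rewrite -[1]mulr1; apply: ler_pM.
set p := \prod_(A <- s | P A) sigma A in IHs p_ge1 *.
have [E rE sE] := IHs t; rewrite gE.
have rhot : 0 <= rho ^+ t by rewrite exprn_ge0.
have rhot1 : 0 <= rho ^+ t.+1 by rewrite exprn_ge0.
have d_ge0 : 0 <= (tag A)%:R :> R by [].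
have n_ge0 : 0 <= (kron_dim s)%:R :> R by [].
(* For [t = 0] no factor [L] may be kept: [L] tensored with the whole remaining product goes to the
   low-rank part. Its bound lacks the factor [c], whence the need for [1 <= c]. *)
case: t => [|t] in E rE sE rhot rhot1 *.
  exists (S *t E).
    rewrite tensmxDl -addrA -tensmxBr.
    have h1 := mxrank_tens_ler rL (_ : (\rank (kron_map g s))%:R <= (kron_dim s)%:R).
    have h2 := mxrank_tens_ler (rank1 S) rE.
    apply: le_trans (mxrank_add_ler (h1 _) h2) _.
      by rewrite ler_nat rank_leq_row.
    rewrite natrM expr1 in rE *; set d := (tag A)%:R in d_ge0 *.
    set n := (kron_dim s)%:R in n_ge0 *.
    have : 0 <= (c - 1) * (rho * d * n) by rewrite mulr_ge0 ?subr_ge0 // !mulr_ge0.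
    by nra.
  have := sparse_tens sS sE; apply: sparse_le.
  rewrite expr0 !mulr1.
  have : 0 <= c * (sigma A * p) by rewrite !mulr_ge0 //; lra.
  by nra.
have [E' rE' sE'] := IHs t.
(* Choosing [L] at the head uses up one of the allowed factors, so the tail is then expanded to
   order [t] instead of [t.+1]. *)
exists (S *t E + L *t E').
  have -> : (L + S) *t kron_map g s - (S *t E + L *t E') =
            L *t (kron_map g s - E') + S *t (kron_map g s - E).
    by rewrite tensmxDl !tensmxBr [S *t E + _]addrC opprD addrACA.
  have h1 := mxrank_tens_ler rL rE'.
  have h2 := mxrank_tens_ler (rank1 S) rE.
  apply: le_trans (mxrank_add_ler h1 h2) _.
  by rewrite natrM [rho ^+ t.+2]exprS le_eqVlt; apply/orP; left; apply/eqP; ring.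
have sL : sparse D L by apply: sparse_le (sparse_full _).
have := sparse_add (sparse_tens sS sE) (sparse_tens sL sE'); apply: sparse_le.
rewrite [D ^+ t.+1]exprS.
(* Since [1 <= sigma A], the second summand is at most the first, and the sum costs only a factor
   2. *)
have h : 0 <= (sigma A - 1) * (c * p * (D * D ^+ t)).
  rewrite mulr_ge0 ?subr_ge0 // !mulr_ge0 ?exprn_ge0 //; lra.
by nra.
Qed.

End KroneckerLists.

(** * Triangular factors *)

Section Triangular.
Context {R : realType} {F : fieldType}.
Implicit Types (A : sqmx F) (s : seq (sqmx F)).

(** From [1 - v <= expR (- v)] and [(1 - v) * (1 + v + 2 * v ^+ 2) = 1 + v ^+ 2 * (1 - 2 * v)],
    which is at least 1. *)
Lemma expR_le_quad (v : R) : v <= 1 / 2 -> expR v <= 1 + v + 2 * v ^+ 2.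
Proof.
move=> hv; rewrite -[v in expR v]opprK expRN.
have e_ge : 1 - v <= expR (- v) by have := expR_ge1Dx (- v).
have e_gt0 := expR_gt0 (- v).
rewrite -[leLHS]mul1r ler_pdivrMr //.
have q_ge0 : 0 <= 1 + v + 2 * v ^+ 2 by nra.
apply: le_trans (ler_wpM2l q_ge0 e_ge).
have : 0 <= v ^+ 2 * (1 - 2 * v) by rewrite mulr_ge0 ?sqr_ge0 //; lra.
by lra.
Qed.

(** The subtracted term is the mean of a uniform index, so this is a mean-zero variable. *)
Definition centered n (i : 'I_n) : R := i%:R - (n%:R - 1) / 2.

Lemma sum_centered n : \sum_(i < n) centered i = 0.
Proof.
suff : \sum_(i < n) centered i = - \sum_(i < n) centered i by lra.
rewrite {1}(reindex_inj rev_ord_inj) /= -sumrN; apply: eq_bigr => i _.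
rewrite /centered /= natrB // -natr1; lra.
Qed.

Lemma norm_centered n (i : 'I_n) : `|centered i| <= n%:R.
Proof.
have i0 : 0 <= i%:R :> R by [].
have : i%:R + 1 <= n%:R :> R by rewrite natr1 ler_nat.
by rewrite /centered ler_norml => h; apply/andP; split; lra.
Qed.

(** A Hoeffding-type bound on a moment generating function: in the quadratic bound on [expR] the
    linear term sums to 0. *)
Lemma mgf_centered n (B lam : R) : n%:R <= B -> `|lam| * B <= 1 / 2 ->
  \sum_(i < n) expR (lam * centered i) <= n%:R * expR (2 * lam ^+ 2 * B ^+ 2).
Proof.
move=> nB hlam; have n_ge0 : 0 <= n%:R :> R by [].
apply: (@le_trans _ _
    (\sum_(i < n) (1 + lam * centered i + 2 * lam ^+ 2 * B ^+ 2))).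
  apply: ler_sum => i _; have := norm_centered i => hi.
  have hl : `|lam * centered i| <= `|lam| * B.
    by rewrite normrM ler_wpM2l // (le_trans hi).
  have := expR_le_quad (le_trans (ler_norm _) (le_trans hl hlam)).
  move=> /le_trans; apply; rewrite lerD2l.
  rewrite -[(lam * _) ^+ 2]real_normK ?num_real // -mulrA ler_wpM2l //.
  rewrite -[lam ^+ 2]real_normK ?num_real // -exprMn.
  by rewrite ler_pXn2r ?nnegrE // mulr_ge0 // (le_trans _ nB).
rewrite !big_split /= -mulr_sumr sum_centered mulr0 addr0 !sumr_const card_ord.
rewrite -mulrnDl -[leLHS]mulr_natl ler_wpM2l //.
exact: expR_ge1Dx.
Qed.

(** This is one row or column of a triangular factor: the diagonal position contributes at most 1
    and each other one at most [expR (- theta)]. *)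
Lemma geometric_count n (B theta : R) (f : pred 'I_n) (c : 'I_n -> R) i0 :
  n%:R <= B -> 0 <= theta -> c i0 = 0 ->
  (forall j, j != i0 -> f j -> 1 <= c j) ->
  \sum_j (f j)%:R * expR (- theta * c j) <= 1 + B * expR (- theta).
Proof.
move=> nB th_ge0 c0 hc; rewrite (bigD1 i0) //= c0 mulr0 expR0 mulr1.
apply: lerD; first by rewrite lern1 leq_b1.
have : \sum_(j | j != i0) (f j)%:R * expR (- theta * c j) <=
       \sum_(j < n) expR (- theta).
  rewrite big_mkcond; apply: ler_sum => j _; case: ifPn => [nj|_]; last first.
    exact: expR_ge0.
  case fj : (f j); last by rewrite mul0r expR_ge0.
  by rewrite mul1r ler_expR; have := hc j nj fj; nra.
move=> /le_trans; apply; rewrite sumr_const card_ord -mulr_natl.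
by rewrite ler_wpM2r ?expR_ge0.
Qed.

Context (Q : pred (sqmx F)) (B : R) (g : forall A, 'M[F]_(tag A))
  (gQN : forall A, ~~ Q A -> sparse (1 : R) (g A))
  (gQ : forall A, Q A ->
    (tag A)%:R <= B /\ forall i j : 'I_(tag A), (j < i)%N -> g A i j = 0).

Definition item_weight A (i : 'I_(tag A)) : R := if Q A then centered i else 0.

(** An index is read as one digit per factor; the weight is the deviation from its mean of the sum
    of the digits belonging to [Q]. *)
Fixpoint weight s : 'I_(kron_dim s) -> R :=
  if s is A :: s' then
    fun x => item_weight (mxtens_unindex x).1 + weight (mxtens_unindex x).2
  else fun=> 0.

Lemma weight_cons A s (x : 'I_(tag A * kron_dim s)) : @weight (A :: s) x =
  item_weight (mxtens_unindex x).1 + weight (mxtens_unindex x).2.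
Proof. by []. Qed.

Lemma count_cons A s : count Q (A :: s) = (Q A + count Q s)%N.
Proof. by []. Qed.

(** The digits of a uniform index are independent, so the exponential moment factors over the
    list. *)
Lemma mgf_weight lam s : `|lam| * B <= 1 / 2 ->
  \sum_x expR (lam * @weight s x) <=
  (kron_dim s)%:R * expR (2 * lam ^+ 2 * B ^+ 2) ^+ count Q s.
Proof.
move=> hlam; elim: s => [|A s IHs].
  by rewrite big_ord1 mulr0 expR0 mulr1.
under eq_bigr => x _ do rewrite weight_cons mulrDr expRD.
rewrite -(mulr_sum (fun i => expR (lam * item_weight i))
                   (fun j => expR (lam * @weight s j))).
rewrite natrM count_cons exprD mulrACA; apply: ler_pM => //; try by apply: sumr_ge0 => *; apply: expR_ge0.
rewrite /item_weight; case: (boolP (Q A)) => [QA|_]; last first.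
  under eq_bigr => i _ do rewrite mulr0 expR0.
  by rewrite expr0 mulr1 sumr_const card_ord.
by rewrite expr1; apply: mgf_centered => //; case: (gQ QA).
Qed.

(** At a nonzero entry every digit in [Q] of [y] is at least that of [x], so each such digit that
    differs raises the weight by 1 or more and is penalised by [expR (- theta)]. The sum factors
    over the list. *)
Lemma row_count theta s (x : 'I_(kron_dim s)) : 0 <= theta ->
  \sum_y (kron_map g s x y != 0)%:R * expR (- theta * (weight y - weight x)) <=
  (1 + B * expR (- theta)) ^+ count Q s.
Proof.
move=> th_ge0; elim: s x => [|A s IHs] x.
  by rewrite big_ord1 subrr mulr0 expR0 mulr1 lern1 leq_b1.
case: (mxtens_indexP x) => i j.
under eq_bigr => y _ do rewrite !weight_cons mxE mxtens_indexK mulf_eq0 negb_or -mulnb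
  natrM opprD addrACA mulrDr expRD mulrACA.
rewrite -(mulr_sum
  (fun k => (g A i k != 0)%:R * expR (- theta * (item_weight k - item_weight i)))
  (fun k => (kron_map g s j k != 0)%:R *
     expR (- theta * (@weight s k - @weight s j)))).
rewrite count_cons exprD; apply: ler_pM => //;
  try by apply: sumr_ge0 => *; rewrite mulr_ge0 ?expR_ge0.
rewrite /item_weight; case: (boolP (Q A)) => [QA|nQA]; last first.
  rewrite expr0; under eq_bigr => k _ do rewrite subrr mulr0 expR0 mulr1.
  by case: (gQN nQA) => h _; exact: h.
have [dB tri] := gQ QA; rewrite expr1.
apply: (geometric_count (i0 := i)) => //; first by rewrite subrr.
move=> k nk nz; have : (i < k)%N.
  rewrite ltn_neqAle eq_sym nk leqNgt; apply: contra nz => ki.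
  by rewrite tri.
by rewrite -(ler_nat R) -natr1 /centered; lra.
Qed.

Lemma col_count theta s (y : 'I_(kron_dim s)) : 0 <= theta ->
  \sum_x (kron_map g s x y != 0)%:R * expR (- theta * (weight y - weight x)) <=
  (1 + B * expR (- theta)) ^+ count Q s.
Proof.
move=> th_ge0; elim: s y => [|A s IHs] y.
  by rewrite big_ord1 subrr mulr0 expR0 mulr1 lern1 leq_b1.
case: (mxtens_indexP y) => i j.
under eq_bigr => x _ do rewrite !weight_cons mxE mxtens_indexK mulf_eq0 negb_or -mulnb
  natrM opprD addrACA mulrDr expRD mulrACA.
rewrite -(mulr_sum
  (fun k => (g A k i != 0)%:R * expR (- theta * (item_weight i - item_weight k)))
  (fun k => (kron_map g s k j != 0)%:R *
     expR (- theta * (@weight s j - @weight s k)))).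
rewrite count_cons exprD; apply: ler_pM => //;
  try by apply: sumr_ge0 => *; rewrite mulr_ge0 ?expR_ge0.
rewrite /item_weight; case: (boolP (Q A)) => [QA|nQA]; last first.
  rewrite expr0; under eq_bigr => k _ do rewrite subrr mulr0 expR0 mulr1.
  case: (gQN nQA) => _ /(_ i)/(le_trans _); apply.
  by apply: ler_sum => k _; rewrite mxE.
have [dB tri] := gQ QA; rewrite expr1.
apply: (geometric_count (i0 := i)) => //; first by rewrite subrr.
move=> k nk nz; have : (k < i)%N.
  rewrite ltn_neqAle nk leqNgt; apply: contra nz => ki.
  by rewrite tri.
by rewrite -(ler_nat R) -natr1 /centered; lra.
Qed.

(** Chernoff's bound; the sign [sg] selects the upper or the lower tail. *)
Lemma card_weight_gt (lam tau : R) s : 0 <= B -> 0 <= lam -> lam * B <= 1 / 2 ->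
  forall sg : R, `|sg| = 1 ->
  #|[pred x | tau < sg * @weight s x]|%:R <=
  expR (2 * lam ^+ 2 * B ^+ 2 * (count Q s)%:R - lam * tau) * (kron_dim s)%:R.
Proof.
move=> B_ge0 lam_ge0 hlam sg sg1.
have sg2 : sg ^+ 2 = 1 by rewrite -real_normK ?num_real // sg1 expr1n.
have hl : `|sg * lam| * B <= 1 / 2 by rewrite normrM sg1 (ger0_norm lam_ge0) (mul1r lam).
have h := mgf_weight s hl; rewrite exprMn sg2 mul1r in h.
rewrite expRD expRM_natr mulrAC [X in X * _]mulrC expRN ler_pdivlMr ?expR_gt0 //.
apply: le_trans h; rewrite -sum1_card natr_sum mulr_suml big_mkcond /=.
apply: ler_sum => x _; rewrite inE; case: ltP => [hx|_]; last exact: expR_ge0.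
by rewrite mul1r ler_expR -mulrA mulrCA ler_wpM2l // ltW.
Qed.

(* A nonzero entry (x, y) of a product of upper triangular factors has
   [x <= y] coordinatewise, and the sum of the coordinates is concentrated:
   outside few exceptional rows and columns [x] and [y] differ in few places. *)
Lemma nonrigid_kron_triangular theta lam tau s :
  0 <= B -> 0 <= theta -> 0 <= lam -> lam * B <= 1 / 2 ->
  nonrigid (kron_map g s)
    (2 * expR (2 * lam ^+ 2 * B ^+ 2 * (count Q s)%:R - lam * tau))
    (expR (2 * theta * tau) * (1 + B * expR (- theta)) ^+ count Q s).
Proof.
move=> B_ge0 th_ge0 lam_ge0 hlam; set M := kron_map g s.
pose W := @weight s.
(* One-sided cuts suffice: only an upper bound [2 * tau] on [W y - W x] is wanted. *)
pose Z := \matrix_(x, y) if (- tau <= W x) && (W y <= tau) then M x y else 0.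
exists Z; last first.
  (* On the support of [Z] the two exponentials have product at least 1, which reduces the count to
     [row_count] and [col_count]. *)
  have h x y : (Z x y != 0)%:R <= (M x y != 0)%:R *
      expR (- theta * (W y - W x)) * expR (2 * theta * tau).
    rewrite mxE; case: ifP => [/andP[hx hy]|_]; last first.
      by rewrite eqxx !mulr_ge0 ?expR_ge0.
    case: (M x y != 0); last by rewrite !mul0r.
    rewrite mul1r -expRD; apply: (@le_trans _ _ (expR 0)); first by rewrite expR0.
    rewrite ler_expR.
    have : 0 <= theta * (2 * tau - (W y - W x)) by rewrite mulr_ge0 //; lra.
    by lra.
  split=> i.
    apply: le_trans (ler_sum _ (fun j _ => h i j)) _; rewrite -mulr_suml mulrC.
    by rewrite ler_wpM2l ?expR_ge0 //; exact: row_count.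
  under eq_bigr => k _ do rewrite mxE.
  apply: le_trans (ler_sum _ (fun j _ => h j i)) _; rewrite -mulr_suml mulrC.
  by rewrite ler_wpM2l ?expR_ge0 //; exact: col_count.
(* [X] collects the removed rows, and [Y] the removed columns restricted to the other rows. *)
pose X := \matrix_(x, y) if - tau <= W x then 0 else M x y.
pose Y := \matrix_(x, y) if (- tau <= W x) && (tau < W y) then M x y else 0.
have -> : M - Z = X + Y.
  apply/matrixP=> x y; rewrite !mxE ltNge.
  by case: (_ <= W x); case: (W y <= _) => /=;
    rewrite ?subrr ?subr0 ?addr0 ?add0r.
have rX : (\rank X <= #|[pred x | (tau < -1 * W x)%R]|)%N.
  apply: mxrank_nz_rows => x; rewrite /= -leNgt => hx.
  by apply/rowP=> y; rewrite !mxE ifT //; lra.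
have rY : (\rank Y <= #|[pred x | (tau < 1 * W x)%R]|)%N.
  rewrite -mxrank_tr; apply: mxrank_nz_rows => y; rewrite /= mul1r => /negPf hy.
  by apply/rowP=> x; rewrite !mxE hy andbF.
rewrite mulrDl mul1r mulrDl; apply: mxrank_add_ler.
  apply: le_trans (card_weight_gt tau s B_ge0 lam_ge0 hlam (normrN1 _)).
  by rewrite ler_nat.
apply: le_trans (card_weight_gt tau s B_ge0 lam_ge0 hlam (normr1 _)).
by rewrite ler_nat.
Qed.

End Triangular.

(** * Factors of bounded dimension *)

Section SmallFactors.
Context {R : realType}.

Lemma nonrigid_kron_triangular_exp (B e : R) : 1 <= B -> 0 < e -> e <= 1 ->
  exists2 kappa : R, 0 < kappa &
  forall (F : fieldType) (Q : pred (sqmx F)) (g : forall A : sqmx F, 'M[F]_(tag A)) s,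
  (forall A, ~~ Q A -> sparse (1 : R) (g A)) ->
  (forall A, Q A ->
    (tag A)%:R <= B /\ forall i j : 'I_(tag A), (j < i)%N -> g A i j = 0) ->
  nonrigid (kron_map g s) (2 * expR (- kappa * (count Q s)%:R))
    (expR (e * (count Q s)%:R)).
Proof.
move=> B_ge1 e_gt0 e_le1; have B_gt0 : 0 < B by lra.
(* As [theta <= expR theta], this gives [B * expR (- theta) <= e / 2]. Below, [delta] is such that
   [2 * theta * delta] is the other half of [e]; the cut will be at [tau = delta * k]. *)
pose theta := 2 * B / e; have th_gt0 : 0 < theta by rewrite divr_gt0 // mulr_gt0.
pose delta := e ^+ 2 / (8 * B); have B8 : 0 < 8 * B by lra.
have de_gt0 : 0 < delta by rewrite divr_gt0 // exprn_gt0.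
have de_le1 : delta <= 1 by rewrite ler_pdivrMr //; nra.
have thde : 2 * theta * delta = e / 2.
  by rewrite /theta /delta; field; rewrite !gt_eqF.
(* The minimiser of [2 * lam ^+ 2 * B ^+ 2 - lam * delta]; the minimum is [- kappa]. *)
pose lam := delta / (4 * B ^+ 2).
have lam_gt0 : 0 < lam by rewrite divr_gt0 // mulr_gt0 // exprn_gt0.
have lamB : lam * B <= 1 / 2.
  have -> : lam * B = delta / (4 * B) by rewrite /lam; field; rewrite gt_eqF.
  by rewrite ler_pdivrMr; lra.
pose kappa := delta ^+ 2 / (8 * B ^+ 2).
exists kappa; first by rewrite divr_gt0 ?exprn_gt0 // mulr_gt0 // exprn_gt0.
move=> F Q g s hQN hQ; set k := (count Q s)%:R.
have := nonrigid_kron_triangular hQN hQ (delta * k) s (ltW B_gt0) (ltW th_gt0)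
  (ltW lam_gt0) lamB.
apply: nonrigid_le.
  rewrite ler_wpM2l // ler_expR -/k le_eqVlt; apply/orP; left; apply/eqP.
  by rewrite /kappa /lam; field; rewrite gt_eqF.
have -> : e * k = 2 * theta * (delta * k) + e / 2 * k.
  by rewrite mulrA thde; field.
rewrite expRD ler_wpM2l ?expR_ge0 // expRM_natr lerXn2r ?nnegrE ?expR_ge0 //.
  by rewrite addr_ge0 // mulr_ge0 ?expR_ge0 // ltW.
apply: le_trans (expR_ge1Dx _); rewrite lerD2l expRN ler_pdivrMr ?expR_gt0 //.
apply: (@le_trans _ _ (e / 2 * theta)).
  by rewrite le_eqVlt; apply/orP; left; apply/eqP; rewrite /theta; field; rewrite gt_eqF.
rewrite ler_wpM2l ?divr_ge0 //; first exact: ltW.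
by have := expR_ge1Dx theta; lra.
Qed.

(** Asking only that [P] be 1-sparse lets a matrix of dimension at most 1 be its own [P]. Its
    triangular factors are then identities, so it does not enter the counts. *)
Lemma lup_factor (F : fieldType) d (A : 'M[F]_d) :
  exists p : 'M[F]_d * 'M[F]_d * 'M[F]_d, let: (P, L, U) := p in
  [/\ A = P *m L *m U, sparse (1 : R) P,
      forall i j : 'I_d, (i < j)%N -> L i j = 0,
      forall i j : 'I_d, (j < i)%N -> U i j = 0 &
      (d <= 1)%N -> L = 1%:M /\ U = 1%:M].
Proof.
case: d A => [|[|d]] A.
- exists (A, 1%:M, 1%:M); rewrite !mulmx1; split=> //; first by split=> -[].
  + by case.
  + by case.
- exists (A, 1%:M, 1%:M); rewrite !mulmx1; split=> //; first exact: sparse_full.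
  + by move=> i j; rewrite !ord1.
  + by move=> i j; rewrite !ord1.
have := cormen_lup_correct A; have := cormen_lup_perm A.
have := @cormen_lup_lower _ _ A; have := @cormen_lup_upper _ _ A.
case: (cormen_lup A) => [[P L] U] /= hU hL /is_perm_mxP[p ->] PA.
exists (perm_mx p^-1, L, U); split=> //.
- by rewrite -mulmxA -[L *m U]PA mulmxA -perm_mxM mulVg perm_mx1 mul1mx.
- exact: sparse_perm.
- by move=> i j ij; rewrite hL ?(ltnW ij) //; case: eqP ij => // ->; rewrite ltnn.
Qed.

(** The Kronecker product is the product of those of the [P], the [L] and the [U]. The first is
    1-sparse, and the lower triangular one is handled by transposition. *)
Lemma nonrigid_kron_small (B e : R) : 1 <= B -> 0 < e -> e <= 1 ->
  exists2 kappa : R, 0 < kappa &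
  forall (F : fieldType) (P : pred (sqmx F)) (g : forall A : sqmx F, 'M[F]_(tag A)) s,
  (forall A, ~~ P A -> g A = 1%:M) -> (forall A, P A -> (tag A)%:R <= B) ->
  let k := (count (fun A => P A && (1 < tag A)%N) s)%:R in
  nonrigid (kron_map g s) (4 * expR (- kappa * k)) (expR (2 * e * k)).
Proof.
move=> B_ge1 e_gt0 e_le1.
have [kappa k_gt0 tri] := nonrigid_kron_triangular_exp B_ge1 e_gt0 e_le1.
exists kappa => // F P g s gN gP k.
pose f A := sval (cid (lup_factor (g A))).
have fP A : let: (P, L, U) := f A in
    [/\ g A = P *m L *m U, sparse (1 : R) P,
      forall i j : 'I_(tag A), (i < j)%N -> L i j = 0,
      forall i j : 'I_(tag A), (j < i)%N -> U i j = 0 &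
      (tag A <= 1)%N -> L = 1%:M /\ U = 1%:M].
  rewrite /f; case: (cid (lup_factor (g A))) => -[[p l] u] hp /=; exact: hp.
pose gp A : 'M[F]_(tag A) := if P A then (f A).1.1 else 1%:M.
pose gl A : 'M[F]_(tag A) := if P A then (f A).1.2 else 1%:M.
pose gu A : 'M[F]_(tag A) := if P A then (f A).2 else 1%:M.
pose Q A := P A && (1 < tag A)%N.
have -> : kron_map g s = kron_map gp s *m kron_map gl s *m kron_map gu s.
  rewrite !kron_map_mul; apply: eq_kron_map => A _; rewrite /gp /gl /gu.
  have [PA|nPA] := boolP (P A); last by rewrite gN // !mulmx1.
  by move: (fP A); case: (f A) => [[p l] u] /= [].
have sp : nonrigid (kron_map gp s) (0 : R) 1.
  apply: nonrigid_sparse; have -> : 1 = \prod_(A <- s) 1 :> R by rewrite big1_eq.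
  apply: sparse_kron_map => A; rewrite /gp; case: ifP => _; last exact: sparse1.
  by move: (fP A); case: (f A) => [[p l] u] /= [].
have su : nonrigid (kron_map gu s) (2 * expR (- kappa * k)) (expR (e * k)).
  apply: tri => A; rewrite /Q /gu.
    case: (P A) => /=; last by move=> _; exact: sparse1.
    rewrite -leqNgt => A1; move: (fP A); case: (f A) => [[p l] u] /= [_ _ _ _].
    by case=> // _ ->; exact: sparse1.
  case/andP=> PA _; split; first exact: gP.
  by rewrite PA; move: (fP A); case: (f A) => [[p l] u] /= [].
have sl : nonrigid (kron_map gl s) (2 * expR (- kappa * k)) (expR (e * k)).
  rewrite -[kron_map gl s]trmxK; apply: nonrigid_tr; rewrite kron_map_tr.
  apply: tri => A; rewrite /Q /gl.
    case: (P A) => /=; last by move=> _; apply: sparse_tr; exact: sparse1.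
    rewrite -leqNgt => A1; move: (fP A); case: (f A) => [[p l] u] /= [_ _ _ _].
    by case=> // -> _; apply: sparse_tr; exact: sparse1.
  case/andP=> PA _; split; first exact: gP.
  move=> i j ij; rewrite mxE PA; move: (fP A); case: (f A) => [[p l] u] /= [_ _ h _ _].
  exact: h.
have := nonrigid_mul (nonrigid_mul sp sl) su; apply: nonrigid_le.
  by lra.
by rewrite mul1r -expRD -mulrDl; have -> : e + e = 2 * e by lra.
Qed.

End SmallFactors.

(** * Levels and asymptotics *)

Section Levels.

(** Dimensions of one positive level agree up to squaring, while only about log log n levels occur
    below n. *)
Definition level (d : nat) : nat := trunc_log 2 (trunc_log 2 d).

Lemma level_ltn d : (d < 2 ^ (2 ^ (level d).+1))%N.
Proof.
apply: leq_trans (trunc_log_ltn d (isT : 1 < 2)%N) _.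
by rewrite leq_exp2l // trunc_log_ltn.
Qed.

(** Level 0 is excluded because it contains 0 and 1, through the default value of [trunc_log]. *)
Lemma level_leq d : (0 < level d)%N -> (2 ^ (2 ^ level d) <= d)%N.
Proof.
move=> l_gt0; have m_gt0 : (0 < trunc_log 2 d)%N.
  by move: l_gt0; rewrite /level; case: (trunc_log 2 d).
have d_gt0 : (0 < d)%N by move: m_gt0; case: d {l_gt0}.
apply: leq_trans (trunc_logP (isT : 1 < 2)%N d_gt0).
by rewrite leq_exp2l // trunc_logP.
Qed.

Lemma leq_level d n : (d <= n)%N -> (level d <= level n)%N.
Proof. by move=> dn; rewrite !leq_trunc_log. Qed.

Lemma level_exp j : level (2 ^ (2 ^ j)) = j.
Proof. by rewrite /level !trunc_expnK. Qed.

End Levels.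

Section Asymptotics.
Context {R : realType}.
Local Notation ln2 := (ln (2 : R)).

Lemma nat_ubound (x : R) : exists n : nat, x <= n%:R.
Proof.
exists (Num.bound `|x|); apply: le_trans (ler_norm _) (ltW _).
exact: archi_boundP.
Qed.

Lemma gt0_powRE (x y : R) : 0 < x -> x `^ y = expR (y * ln x).
Proof. by rewrite /powR => x_gt0; case: eqP x_gt0 => // ->; rewrite ltxx. Qed.

Lemma ln2_gt0 : 0 < ln2.
Proof. by rewrite ln_gt0 // ltr1n. Qed.

Lemma ln2_le1 : ln2 <= 1.
Proof. by apply: (@le_ln1Dx R 1); lra. Qed.

Lemma natrX2E n : (2 ^ n)%:R = expR (n%:R * ln2) :> R.
Proof. by rewrite expRM_natl lnK ?posrE // natrX. Qed.

Lemma ln_natrX2 n : ln ((2 ^ n)%:R : R) = n%:R * ln2.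
Proof. by rewrite natrX2E expRK. Qed.

(** In [rig_gamma a eps d * ln d] the logarithm of [d] cancels, leaving a constant times the square
    of log log d, which is at least of order [j ^+ 2]. *)
Lemma rigidity_rank_decay (a eps : R) : 1 < a -> 0 < eps ->
  exists2 c : R, 0 < c & exists j0 : nat, forall j d : nat, (j0 <= j)%N ->
  (2 ^ (2 ^ j) <= d)%N ->
  d%:R `^ (1 - rig_gamma a eps d) <= expR (- c * j%:R ^+ 2) * d%:R.
Proof.
move=> a_gt1 eps_gt0; have la_gt0 : 0 < ln a by rewrite ln_gt0.
have l2 := ln2_gt0; have e3 : 0 < eps ^+ 3 by rewrite exprn_gt0.
pose c := 3 * ln2 ^+ 2 / (eps ^+ 3 * ln a).
have c_gt0 : 0 < c by rewrite divr_gt0 // mulr_gt0 // exprn_gt0.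
(* From [j0] on, half of [j%:R * ln2] absorbs the shift [ln (ln2 / ln a)] due to the base [a]. *)
have [j0 hj0] := nat_ubound (- 2 * ln (ln2 / ln a) / ln2).
exists c => //; exists j0 => j d jj0 hd.
have d_gt0 : (0 < d)%N by apply: leq_trans hd; rewrite expn_gt0.
have dR : 0 < d%:R :> R by rewrite ltr0n.
have x_ge : (2 ^ j)%:R * ln2 <= ln (d%:R : R).
  by rewrite -ln_natrX2 ler_ln ?posrE ?ltr0n ?expn_gt0 // ler_nat.
set x := ln (d%:R : R) in x_ge *.
have x_gt0 : 0 < x by apply: lt_le_trans x_ge; rewrite mulr_gt0 // ltr0n expn_gt0.
have y_ge : j%:R * ln2 / 2 <= ln (x / ln a).
  have -> : j%:R * ln2 / 2 = j%:R * ln2 - j%:R * ln2 / 2 by lra.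
  apply: (@le_trans _ _ (j%:R * ln2 + ln (ln2 / ln a))).
    rewrite lerD2l; move: hj0; rewrite ler_pdivrMr // => hj0.
    have : j0%:R * ln2 <= j%:R * ln2 by rewrite ler_wpM2r ?(ltW l2) // ler_nat.
    by lra.
  rewrite -ln_natrX2 -lnM ?posrE ?divr_gt0 ?ltr0n ?expn_gt0 //.
  rewrite ler_ln ?posrE ?divr_gt0 // ?mulr_gt0 ?invr_gt0 ?ltr0n ?expn_gt0 //.
  by rewrite mulrA ler_pM2r ?invr_gt0.
rewrite gt0_powRE // -/x mulrBl mul1r expRD lnK ?posrE // mulrC.
rewrite ler_pM2r // ler_expR mulNr lerN2 /rig_gamma /logb -/x.
have -> : 12 * (ln (x / ln a) / ln a) ^+ 2 / (eps ^+ 3 * (x / ln a)) * x =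
    12 / (eps ^+ 3 * ln a) * ln (x / ln a) ^+ 2.
  by field; rewrite !gt_eqF.
have -> : c * j%:R ^+ 2 = 12 / (eps ^+ 3 * ln a) * (j%:R * ln2 / 2) ^+ 2.
  by rewrite /c; field; rewrite !gt_eqF.
have y0 : 0 <= j%:R * ln2 / 2 by rewrite divr_ge0 // mulr_ge0 // ltW.
apply: ler_wpM2l; first by apply: divr_ge0 => //; apply: mulr_ge0; apply: ltW.
by rewrite lerXn2r ?nnegrE // (le_trans y0).
Qed.

(** Here [m] stands for the number of factors of level [j], up to a constant. The threshold must be
    uniform in [j]: a high level has a large [j ^+ 2], a low one has many factors. *)
Lemma exp_decay_le (c1 c2 c3 : R) : 0 < c1 -> 0 < c2 -> 0 < c3 ->
  exists J1 : nat, forall J j : nat, (J1 <= J)%N -> (0 < j)%N ->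
  forall m : R, 1 <= m ->
  c3 * (2 ^ J)%:R <= m * ((2 ^ j)%:R * J.+1%:R) ->
  expR (- c1 * j%:R ^+ 2 * m) <= c2 / ((2 ^ J)%:R * J.+1%:R).
Proof.
move=> c1_gt0 c2_gt0 c3_gt0; have l2 := ln2_gt0.
pose c5 := c3 * ln2 ^+ 3 / 48.
have c5_gt0 : 0 < c5 by rewrite divr_gt0 // mulr_gt0 // exprn_gt0.
have [n1 h1] := nat_ubound (- ln c2).
have [n2 h2] := nat_ubound (12 / c1).
have [n3 h3] := nat_ubound (6 / (c1 * c5)).
exists (maxn 1 (maxn n1 (maxn n2 n3))) => J j; rewrite !geq_max.
case/and4P=> J_gt0 J1 J2 J3 j_gt0 m m_ge1 hm.
have JR : 1 <= J%:R :> R by rewrite ler1n.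
have jR : 1 <= j%:R :> R by rewrite ler1n.
have {}h1 : - ln c2 <= J%:R by apply: le_trans h1 _; rewrite ler_nat.
have {}h2 : 12 <= J%:R * c1.
  by rewrite -ler_pdivrMr //; apply: le_trans h2 _; rewrite ler_nat.
have {}h3 : 6 <= J%:R * (c1 * c5).
  have c15 : 0 < c1 * c5 by rewrite mulr_gt0.
  by rewrite -(ler_pdivrMr _ _ c15); apply: le_trans h3 _; rewrite ler_nat.
(* One [J] pays for each of [2 ^ J], [J.+1] and the inverse of [c2]. *)
have big : 3 * J%:R <= c1 * j%:R ^+ 2 * m.
  have [Jj|jJ] := leqP J (j + j).
    have {}Jj : J%:R <= 2 * j%:R :> R by rewrite mulrDl mul1r -natrD ler_nat.
    have h4 : J%:R ^+ 2 / 4 <= j%:R ^+ 2 :> R by nra.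
    apply: (@le_trans _ _ (c1 * (J%:R ^+ 2 / 4) * 1)); first by nra.
    apply: ler_pM => //; last by rewrite ler_pM2l.
    by apply: mulr_ge0; [exact: ltW | rewrite divr_ge0 ?sqr_ge0].
  set i := (J - j)%N.
  have Ji : (J = i + j)%N by rewrite subnK // ltnW // (leq_ltn_trans (leq_addr j j)).
  have iR : J%:R / 2 <= i%:R :> R.
    have : J%:R < i%:R + i%:R :> R.
      rewrite -natrD ltr_nat; move: jJ; rewrite Ji.
      by rewrite ltn_add2r => ji; rewrite ltn_add2l.
    by lra.
  (* A cubic lower bound is enough: after division by [J.+1] it leaves [m] of order [J ^+ 2]. The 48
     in [c5] is this 6 times the 8 from [i >= J / 2]. *)
  have e_ge : (i%:R * ln2) ^+ 3 / 6 <= (2 ^ i)%:R.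
    rewrite natrX2E; have := @expR_ge1Dxn R (i%:R * ln2) 2.
    by rewrite mulr_ge0 ?(ltW l2) // => /(_ isT); rewrite (_ : 3`!%:R = 6) //; lra.
  have {}hm : c3 * (2 ^ i)%:R <= m * J.+1%:R.
    have pj : 0 < (2 ^ j)%:R :> R by rewrite ltr0n expn_gt0.
    rewrite -(ler_pM2r pj); move: hm; rewrite {1}Ji expnD natrM => hm.
    by apply: le_trans (le_trans _ hm) _; rewrite ?mulrA // -!mulrA [J.+1%:R * _]mulrC.
  have J1R : J.+1%:R <= 2 * J%:R :> R by rewrite -natr1; lra.
  have i3 : (J%:R / 2) ^+ 3 <= i%:R ^+ 3 :> R by rewrite lerXn2r ?nnegrE ?divr_ge0.
  have q1 : c5 * J%:R ^+ 3 <= c3 * (2 ^ i)%:R.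
    apply: le_trans (ler_wpM2l (ltW c3_gt0) e_ge).
    have -> : c5 * J%:R ^+ 3 = c3 * ((ln2 ^+ 3 * (J%:R / 2) ^+ 3) / 6).
      by rewrite /c5; field.
    rewrite ler_pM2l // ler_pM2r ?invr_gt0 //.
    rewrite [leRHS]exprMn [leLHS]mulrC; apply: ler_wpM2r => //.
    by rewrite exprn_ge0 // ltW.
  have q2 : c5 * J%:R ^+ 2 <= 2 * m.
    have : c5 * J%:R ^+ 2 * J%:R <= 2 * m * J%:R.
      have : m * J.+1%:R <= m * (2 * J%:R) by rewrite ler_wpM2l //; lra.
      by move: q1; rewrite exprSr; lra.
    by rewrite ler_pM2r //; lra.
  apply: (@le_trans _ _ (c1 * m)).
    have : c1 * (c5 * J%:R ^+ 2) <= c1 * (2 * m) by rewrite ler_pM2l.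
    have : 6 * J%:R <= J%:R * (c1 * c5) * J%:R by rewrite ler_wpM2r.
    by lra.
  rewrite -mulrA ler_pM2l // -[leLHS]mul1r ler_wpM2r //; first lra.
  by rewrite exprn_ege1.
apply: (@le_trans _ _ (expR (- (3 * J%:R)))); first by rewrite ler_expR; lra.
rewrite ler_pdivlMr ?mulr_gt0 ?ltr0n ?expn_gt0 //.
have j1 : J.+1%:R <= expR J%:R :> R by have := expR_ge1Dx (J%:R : R); rewrite -natr1; lra.
have p2 : (2 ^ J)%:R <= expR J%:R :> R.
  by rewrite natrX2E ler_expR; have := ln2_le1; nra.
apply: (@le_trans _ _ (expR (- (3 * J%:R)) * (expR J%:R * expR J%:R))).
  by rewrite ler_pM2l ?expR_gt0 // ler_pM.
rewrite -!expRD -[leRHS]lnK ?posrE // ler_expR; lra.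
Qed.

End Asymptotics.

(** * Classes of factors *)

Section Classes.
Context {R : realType} {F : fieldType}.
Implicit Types (A : sqmx F) (s : seq (sqmx F)) (P : pred (sqmx F)).

Definition select P A : 'M[F]_(tag A) := if P A then tagged A else 1%:M.

Lemma prodr_const_count P s (c : R) : \prod_(A <- s | P A) c = c ^+ count P s.
Proof. by rewrite big_const_seq iter_mulr_1. Qed.

Lemma ler_prod_count P s (f : sqmx F -> R) (c : R) :
  (forall A, P A -> 0 <= f A <= c) -> \prod_(A <- s | P A) f A <= c ^+ count P s.
Proof. by move=> h; rewrite -prodr_const_count; apply: ler_prod. Qed.

Lemma natr_powR_ge1 (n : nat) (e : R) : (0 < n)%N -> 0 <= e -> 1 <= n%:R `^ e.
Proof.
by move=> n_gt0 e_ge0; apply: le_trans (ler_powR _ e_ge0); rewrite ?powRr0 ?ler1n.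
Qed.

Lemma prodr_powR_ge1 P s (e : R) : 0 <= e -> (forall A, P A -> (0 < tag A)%N) ->
  1 <= \prod_(A <- s | P A) (tag A)%:R `^ e.
Proof.
move=> e_ge0 h; elim/big_ind: _ => // [x y x1 y1|A /h A_gt0].
  by rewrite -[1]mulr1; apply: ler_pM.
by rewrite natr_powR_ge1.
Qed.

(** The whole class goes to the sparse part. The product of powers is at least 1 and gives the bound
    the same form as for the other classes. *)
Lemma nonrigid_class_dense P s (eta e x : R) : 0 <= eta -> 0 <= e ->
  (forall A, P A -> (0 < tag A)%N) -> \prod_(A <- s | P A) (tag A)%:R <= x ->
  nonrigid (kron_map (select P) s) eta
    ((\prod_(A <- s | P A) (tag A)%:R `^ e) * x).
Proof.
move=> eta_ge0 e_ge0 h px.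
have sp : sparse (\prod_(A <- s | P A) (tag A)%:R : R) (kron_map (select P) s).
  rewrite big_mkcond; apply: sparse_kron_map => A; rewrite /select.
  by case: ifP => _; [exact: sparse_full | exact: sparse1].
have := nonrigid_sparse sp; apply: nonrigid_le => //.
have p_ge0 : 0 <= \prod_(A <- s | P A) (tag A)%:R :> R by apply: prodr_ge0.
apply: (le_trans px); rewrite -[leLHS]mul1r ler_wpM2r ?prodr_powR_ge1 //.
exact: le_trans px.
Qed.

(** A class too large to be kept dense has many factors: compare logarithms, using that [ln n] is at
    least [2 ^ J * ln 2]. *)
Lemma class_count_ge (n J k : nat) (e U : R) : 0 < e -> 0 < U ->
  (2 ^ (2 ^ J) <= n)%N -> n%:R `^ (e / J.+1%:R) <= U ^+ k ->
  e * (2 ^ J)%:R * ln 2 <= k%:R * ln U * J.+1%:R.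
Proof.
move=> e_gt0 U_gt0 hn hU.
have n_gt0 : 0 < n%:R :> R by rewrite ltr0n (leq_trans _ hn) // expn_gt0.
have : ln (n%:R `^ (e / J.+1%:R)) <= ln (U ^+ k).
  by rewrite ler_ln ?posrE ?powR_gt0 ?exprn_gt0.
rewrite ln_powR lnXn //.
rewrite -[ln U *+ k]mulr_natl mulrAC ler_pdivrMr ?ltr0n //.
apply: le_trans; rewrite -mulrA ler_pM2l // -ln_natrX2.
by rewrite ler_ln ?posrE // ?ler_nat // ltr0n expn_gt0.
Qed.

(** Of the exponent [3 * eps], one [eps] pays for the sparse parts, one for the at most [t] dense
    factors [L], and one for the [2 ^+ k] terms of the expansion. *)
Lemma nonrigid_class_large P s (eps c eta : R) (j : nat) :
  let J := level (kron_dim s) in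
  0 < eps -> 0 < c -> 0 <= eta -> (0 < j)%N -> (0 < J)%N ->
  4 * ln 2 <= c * j%:R ^+ 2 * eps -> 1 <= (2 ^ j)%:R * eps ->
  (forall A, P A -> level (tag A) = j) ->
  (forall A, P A -> nonrigid (tagged A) (expR (- c * j%:R ^+ 2)) ((tag A)%:R `^ eps)) ->
  (forall m : R, 1 <= m ->
    eps ^+ 2 / 4 * (2 ^ J)%:R <= m * ((2 ^ j)%:R * J.+1%:R) ->
    expR (- (c / 2) * j%:R ^+ 2 * m) <= eta) ->
  nonrigid (kron_map (select P) s) eta
    ((\prod_(A <- s | P A) (tag A)%:R `^ (3 * eps)) *
     (kron_dim s)%:R `^ (eps / J.+1%:R)).
Proof.
move=> J eps_gt0 c_gt0 eta_ge0 j_gt0 J_gt0 hc hj lvP nrP heta.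
have l2 := @ln2_gt0 R.
have hn : (2 ^ (2 ^ J) <= kron_dim s)%N by rewrite level_leq.
have n_ge1 : (0 < kron_dim s)%N by apply: leq_trans hn; rewrite expn_gt0.
have tagl A : P A -> (2 ^ (2 ^ j) <= tag A)%N.
  by move=> PA; rewrite -(lvP A PA) level_leq // lvP.
have tag0 A : P A -> (0 < tag A)%N.
  by move=> /tagl; apply: leq_trans; rewrite expn_gt0.
pose D : R := (2 ^ (2 ^ j.+1))%:R.
have D_ge1 : 1 <= D by rewrite ler1n expn_gt0.
have tagu A : P A -> (tag A)%:R <= D.
  by move=> /lvP lvA; rewrite ler_nat ltnW // -lvA level_ltn.
have e3 : 0 <= 3 * eps by lra.
have [tiny|big] := leP (\prod_(A <- s | P A) (tag A)%:R)
                       ((kron_dim s)%:R `^ (eps / J.+1%:R) : R).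
  exact: nonrigid_class_dense.
set k := count P s.
have hD : \prod_(A <- s | P A) (tag A)%:R <= D ^+ k.
  by apply: ler_prod_count => A PA; rewrite ler0n tagu.
have D_gt0 : 0 < D by lra.
have := class_count_ge eps_gt0 D_gt0 hn (ltW (lt_le_trans big hD)).
rewrite /D ln_natrX2 => hk.
have {}hk : eps * (2 ^ J)%:R <= k%:R * (2 ^ j.+1)%:R * J.+1%:R.
  by rewrite -(ler_pM2r l2); lra.
have dk_ge0 : 0 <= eps / 2 * k%:R by rewrite mulr_ge0 // divr_ge0 // ltW.
(* Since [D] is at most the square of each dimension in the class, [D ^+ t] costs at most the
   product of their powers of exponent [eps]. *)
set t := Num.truncn (eps / 2 * k%:R).
have [tle tgt] : t%:R <= eps / 2 * k%:R /\ eps / 2 * k%:R < t.+1%:R.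
  by apply/andP; rewrite truncn_itv.
have t1 : 1 <= t.+1%:R :> R by rewrite ler1n.
have nr : nonrigid (kron_map (select P) s)
    (2 ^+ k * expR (- c * j%:R ^+ 2) ^+ t.+1)
    (2 ^+ k * (\prod_(A <- s | P A) (tag A)%:R `^ eps) * D ^+ t).
  apply: nonrigid_kron_expand => //; first exact: expR_ge0.
  - by move=> A /negPf nP; rewrite /select nP.
  - by move=> A PA; rewrite /select PA; exact: nrP.
  - move=> A PA; split; first exact: tagu.
    by rewrite natr_powR_ge1 ?tag0 // ltW.
apply: nonrigid_le nr.
  apply: le_trans (heta _ t1 _); last first.
    have : 0 <= (t.+1%:R - eps / 2 * k%:R) * ((2 ^ j)%:R * J.+1%:R).
      by apply: mulr_ge0; rewrite ?mulr_ge0 // subr_ge0 ltW.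
    move: hk; rewrite expnS natrM => hk.
    have : eps * (eps * (2 ^ J)%:R) <= eps * (k%:R * (2 * (2 ^ j)%:R) * J.+1%:R).
      by rewrite ler_pM2l.
    by lra.
  have -> : 2 ^+ k = expR (k%:R * ln 2) :> R by rewrite -natrX2E natrX.
  rewrite -expRM_natr -expRD ler_expR.
  (* The factor [2 ^+ k] consumes at most half of the decay, hence [c / 2] in the hypothesis on
     [eta]. *)
  have k4 : k%:R * (4 * ln 2) <= k%:R * (c * j%:R ^+ 2 * eps) by rewrite ler_wpM2l.
  have : c * j%:R ^+ 2 * (eps / 2 * k%:R) <= c * j%:R ^+ 2 * t.+1%:R.
    by rewrite ler_wpM2l ?(ltW tgt) // mulr_ge0 ?sqr_ge0 // ltW.
  by lra.
have x_ge1 : 1 <= (kron_dim s)%:R `^ (eps / J.+1%:R) :> R.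
  by rewrite natr_powR_ge1 // divr_ge0 // ltW.
have p_ge1 := prodr_powR_ge1 s e3 tag0.
suff h : 2 ^+ k * (\prod_(A <- s | P A) (tag A)%:R `^ eps) * D ^+ t <=
    \prod_(A <- s | P A) (tag A)%:R `^ (3 * eps).
  apply: le_trans h _; rewrite -[leLHS]mulr1 ler_wpM2l //.
  exact: le_trans p_ge1.
have Dt : D ^+ t <= (D `^ (eps / 2)) ^+ k.
  rewrite -!powR_mulrn ?powR_ge0 ?(ltW D_gt0) //.
  by rewrite -powRrM ler_powR.
apply: (@le_trans _ _ (2 ^+ k * (\prod_(A <- s | P A) (tag A)%:R `^ eps) *
                        (D `^ (eps / 2)) ^+ k)).
  rewrite ler_wpM2l // mulr_ge0 ?exprn_ge0 //.
  by apply: prodr_ge0 => A _; exact: powR_ge0.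
rewrite -!prodr_const_count -!big_split /=; apply: ler_prod => A PA.
rewrite !mulr_ge0 ?powR_ge0 //=.
have A_gt0 : 0 < (tag A)%:R :> R by rewrite ltr0n tag0.
have lnA : (2 ^ j)%:R * ln 2 <= ln (tag A)%:R :> R.
  by rewrite -ln_natrX2 ler_ln ?posrE ?ltr0n ?expn_gt0 ?tag0 // ler_nat tagl.
rewrite !gt0_powRE // /D ln_natrX2 expnS natrM.
have e2 : 2 = expR (ln 2) :> R by rewrite lnK ?posrE.
rewrite [X in X * _ * _]e2 -!expRD ler_expR.
have : eps * ((2 ^ j)%:R * ln 2) <= eps * ln (tag A)%:R by rewrite ler_pM2l.
have : 1 * ln 2 <= (2 ^ j)%:R * eps * ln 2 :> R by rewrite ler_pM2r.
by lra.
Qed.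

(** With sparsity exponent [eps * ln 2], a factor of dimension d >= 2 costs 2^(2 eps), which is
    below d^(3 eps). *)
Lemma nonrigid_class_small P s (eps B kappa eta : R) :
  let J := level (kron_dim s) in
  let k := count (fun A => P A && (1 < tag A)%N) s in
  0 < eps -> 2 <= B -> 0 <= eta -> (0 < J)%N ->
  (forall A, P A -> (0 < tag A)%N /\ (tag A)%:R <= B) ->
  nonrigid (kron_map (select P) s) (4 * expR (- kappa * k%:R))
    (expR (2 * (eps * ln 2) * k%:R)) ->
  (eps * (2 ^ J)%:R * ln 2 <= k%:R * ln B * J.+1%:R ->
   4 * expR (- kappa * k%:R) <= eta) ->
  nonrigid (kron_map (select P) s) eta
    ((\prod_(A <- s | P A) (tag A)%:R `^ (3 * eps)) *
     (kron_dim s)%:R `^ (eps / J.+1%:R)).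
Proof.
move=> J k eps_gt0 B_ge2 eta_ge0 J_gt0 hP nr heta.
have l2 := @ln2_gt0 R.
have hn : (2 ^ (2 ^ J) <= kron_dim s)%N by rewrite level_leq.
have n_ge1 : (0 < kron_dim s)%N by apply: leq_trans hn; rewrite expn_gt0.
have e3 : 0 <= 3 * eps by lra.
have tag0 A : P A -> (0 < tag A)%N by case/hP.
have [tiny|big] := leP (\prod_(A <- s | P A) (tag A)%:R)
                       ((kron_dim s)%:R `^ (eps / J.+1%:R) : R).
  exact: nonrigid_class_dense.
have trivial_dim (f : nat -> R) : f 1%N = 1 -> \prod_(A <- s | P A) f (tag A) =
    \prod_(A <- s | P A && (1 < tag A)%N) f (tag A).
  move=> f1; rewrite (bigID (fun A => 1 < tag A)%N) /= [X in _ * X]big1 ?mulr1 //.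
  move=> A /andP[/tag0 A_gt0]; rewrite -leqNgt => A_le1.
  by rewrite (_ : tag A = 1%N) //; apply/eqP; rewrite eqn_leq A_le1.
have hB : \prod_(A <- s | P A) (tag A)%:R <= B ^+ k.
  rewrite (trivial_dim (fun d => d%:R)) //; apply: ler_prod_count => A /andP[/hP[_ h] _].
  by rewrite ler0n.
have B_gt0 : 0 < B by lra.
apply: nonrigid_le nr.
  by apply: heta; apply: class_count_ge hn (ltW (lt_le_trans big hB)).
have x_ge1 : 1 <= (kron_dim s)%:R `^ (eps / J.+1%:R) :> R.
  by rewrite natr_powR_ge1 // divr_ge0 // ltW.
have p_ge1 := prodr_powR_ge1 s e3 tag0.
apply: (@le_trans _ _ (\prod_(A <- s | P A) (tag A)%:R `^ (3 * eps))); last first.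
  by rewrite -[leLHS]mulr1 ler_wpM2l //; exact: le_trans p_ge1.
rewrite (trivial_dim (fun d => d%:R `^ (3 * eps))) ?powR1 // expRM_natr.
rewrite -prodr_const_count; apply: ler_prod => A /andP[PA A_gt1].
rewrite expR_ge0 /= gt0_powRE ?ltr0n ?tag0 // ler_expR.
have : ln 2 <= ln (tag A)%:R :> R.
  by rewrite ler_ln ?posrE ?ltr0n ?tag0 // ler_nat.
move=> /(ler_wpM2l (ltW eps_gt0)) h; have : 0 < eps * ln 2 by rewrite mulr_gt0.
by lra.
Qed.

(** Induction on the number of colours with [nonrigid_mul]. The powers of dimensions multiply up to
    a power of the total dimension, while the overhead [x] is paid once per colour. *)
Lemma nonrigid_kron_colours (good : pred (sqmx F)) (col : sqmx F -> nat) s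
    (eta e x : R) C :
  (forall c, (c < C)%N -> nonrigid (kron_map (select (fun A => good A && (col A == c))) s)
    eta ((\prod_(A <- s | good A && (col A == c)) (tag A)%:R `^ e) * x)) ->
  nonrigid (kron_map (select (fun A => good A && (col A < C)%N)) s) (C%:R * eta)
    ((\prod_(A <- s | good A && (col A < C)%N) (tag A)%:R `^ e) * x ^+ C).
Proof.
elim: C => [|C IHC] hC.
  rewrite mul0r expr0 mulr1 big1 => [|A]; last by rewrite ltn0 andbF.
  apply: nonrigid_sparse; have -> : 1 = \prod_(A <- s) 1 :> R by rewrite big1_eq.
  by apply: sparse_kron_map => A; rewrite /select ltn0 andbF; exact: sparse1.
have := nonrigid_mul (IHC (fun c h => hC c (ltnW h))) (hC C (ltnSn C)).
rewrite kron_map_mul mulrACA -exprSr.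
have colE A : good A && (col A < C.+1)%N =
    (good A && (col A < C)%N) || (good A && (col A == C)).
  by rewrite ltnS leq_eqVlt orbC andb_orr.
have -> : kron_map (fun A => select (fun A => good A && (col A < C)%N) A *m
      select (fun A => good A && (col A == C)) A) s =
    kron_map (select (fun A => good A && (col A < C.+1)%N)) s.
  apply: eq_kron_map => A _; rewrite /select colE.
  case: (good A) => /=; last by rewrite mulmx1.
  by case: ltngtP => _ /=; rewrite ?mulmx1 ?mul1mx.
have <- : \prod_(A <- s | good A && (col A < C.+1)%N) (tag A)%:R `^ e =
    (\prod_(A <- s | good A && (col A < C)%N) (tag A)%:R `^ e) *
    (\prod_(A <- s | good A && (col A == C)) (tag A)%:R `^ e).
  rewrite big_mkcond [X in X * _]big_mkcond [X in _ * X]big_mkcond -big_split /=.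
  apply: eq_bigr => A _; rewrite colE; case: (good A) => /=; last by rewrite mulr1.
  by case: ltngtP => _ /=; rewrite ?mulr1 ?mul1r.
by apply: nonrigid_le => //; rewrite -natr1 mulrDl mul1r.
Qed.

End Classes.

(** * Rigidity of Kronecker products *)

Section Assembly.
Context {R : realType}.

Lemma dvdn_kron_dim (F : fieldType) (A : sqmx F) s : A \in s -> (tag A %| kron_dim s)%N.
Proof.
elim: s => [//|B s IHs]; rewrite in_cons => /orP[/eqP ->|/IHs h] /=.
  exact: dvdn_mulr.
exact: dvdn_mull.
Qed.

Lemma prodr_tag_powR (F : fieldType) (s : seq (sqmx F)) (e : R) :
  \prod_(A <- s) (tag A)%:R `^ e = (kron_dim s)%:R `^ e.
Proof.
elim: s => [|A s IHs] /=; first by rewrite big_nil powR1.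
by rewrite big_cons IHs natrM powRM.
Qed.

Lemma kron_rigidity_bound (a eps b : R) :
  1 < a -> 0 < eps -> eps < 1 / 2 -> 2 <= b ->
  exists N : nat, forall (F : fieldType) (fam : sqmx F -> Prop),
  (forall A : sqmx F, fam A ->
     (tag A)%:R <= b \/
     (rc_rigidity (tagged A)
        (Num.truncn ((tag A)%:R `^ (1 - rig_gamma a eps (tag A)))))%:R
       <= (tag A)%:R `^ eps) ->
  forall s : seq (sqmx F), (forall A, A \in s -> fam A) ->
  let n := kron_dim s in
  (rc_rigidity (kron_map (fun A => tagged A) s)
     (Num.truncn (n%:R / logb a n%:R)))%:R <= n%:R `^ (6 * eps) \/
  (n <= N)%N.
Proof.
move=> a_gt1 eps_gt0 eps_lt b_ge2.
have l2 := @ln2_gt0 R; have l2' := @ln2_le1 R.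
have la : 0 < ln a by rewrite ln_gt0.
have [c c_gt0 [j1 dec]] := rigidity_rank_decay a_gt1 eps_gt0.
have [jb hjb] := nat_ubound b.
have [je hje] := nat_ubound (1 / eps).
have [jc hjc] := nat_ubound (4 * ln 2 / (c * eps)).
(* From level [j0] on, the rank decay holds, dimensions exceed [b], and both numerical conditions of
   [nonrigid_class_large] are met. *)
pose j0 := maxn 1 (maxn j1 (maxn jb (maxn je jc))).
have j0E j : (j0 <= j)%N ->
    [/\ (0 < j)%N, (j1 <= j)%N, (jb <= j)%N, (je <= j)%N & (jc <= j)%N].
  by rewrite /j0 !geq_max => /and5P.
have j0_gt0 : (0 < j0)%N by case: (j0E _ (leqnn j0)).
have hj j : (j0 <= j)%N -> 1 <= (2 ^ j)%:R * eps.
  case/j0E=> _ _ _ hj _; move: hje; rewrite ler_pdivrMr // => /le_trans; apply.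
  by rewrite ler_pM2r // ler_nat (leq_trans hj) // ltnW // ltn_expl.
have hc j : (j0 <= j)%N -> 4 * ln 2 <= c * j%:R ^+ 2 * eps.
  case/j0E=> j_gt0 _ _ _ hj'; move: hjc.
  have ce : 0 < c * eps by rewrite mulr_gt0.
  rewrite (ler_pdivrMr _ _ ce) => /le_trans; apply.
  have h1 : jc%:R <= j%:R :> R by rewrite ler_nat.
  have h2 : 1 <= j%:R :> R by rewrite ler1n.
  have h3 : jc%:R <= j%:R ^+ 2 :> R by nra.
  by have := ler_wpM2r (ltW ce) h3; lra.
pose B : R := (2 ^ (2 ^ j0))%:R.
have B_ge2 : 2 <= B.
  by rewrite ler_nat -[X in (X <= _)%N](expn1 2) leq_exp2l // expn_gt0.
have lB : 0 < ln B by rewrite ln_gt0 //; lra.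
have [kappa ka_gt0 hsmall] : exists2 kappa : R, 0 < kappa &
    forall (F : fieldType) (P : pred (sqmx F)) (g : forall A : sqmx F, 'M[F]_(tag A)) s,
    (forall A, ~~ P A -> g A = 1%:M) -> (forall A, P A -> (tag A)%:R <= B) ->
    let k := (count (fun A => P A && (1 < tag A)%N) s)%:R in
    nonrigid (kron_map g s) (4 * expR (- kappa * k)) (expR (2 * (eps * ln 2) * k)).
  by apply: nonrigid_kron_small; [lra|rewrite mulr_gt0|nra].
(* Chosen so that the [J.+1] classes have total relative rank [ln a / (2 ^ J.+1 * ln 2)], at most
   the inverse of [logb a n] because n < 2^(2^(J+1)). *)
pose c2 := ln a / (2 * ln 2).
have c2_gt0 : 0 < c2 by rewrite divr_gt0 // mulr_gt0.
have [Ja hJa] : exists J1 : nat, forall J j : nat, (J1 <= J)%N -> (0 < j)%N ->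
    forall m : R, 1 <= m ->
    eps ^+ 2 / 4 * (2 ^ J)%:R <= m * ((2 ^ j)%:R * J.+1%:R) ->
    expR (- (c / 2) * j%:R ^+ 2 * m) <= c2 / ((2 ^ J)%:R * J.+1%:R).
  by apply: exp_decay_le => //; rewrite divr_gt0 ?exprn_gt0.
(* The small class uses the decay estimate at [j = 1], and the 2 compensates the factor [2 ^ 1]
   there. *)
pose c3 := 2 * eps * ln 2 / ln B.
have [Jb hJb] : exists J1 : nat, forall J j : nat, (J1 <= J)%N -> (0 < j)%N ->
    forall m : R, 1 <= m ->
    c3 * (2 ^ J)%:R <= m * ((2 ^ j)%:R * J.+1%:R) ->
    expR (- kappa * j%:R ^+ 2 * m) <= (c2 / 4) / ((2 ^ J)%:R * J.+1%:R).
  by apply: exp_decay_le; rewrite ?divr_gt0 ?mulr_gt0.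
pose J1 := maxn 1 (maxn Ja Jb).
exists (2 ^ (2 ^ J1))%N => F fam hfam s sfam n.
have [|n_gt] := leqP n (2 ^ (2 ^ J1)); [by right|left].
have n_gt0 : (0 < n)%N by apply: leq_trans n_gt.
pose J := level n.
have : (J1 <= J)%N by rewrite -[J1]level_exp leq_level // ltnW.
rewrite /J1 !geq_max => /and3P[J_gt0 JJa JJb].
have tag_le A : A \in s -> (tag A <= n)%N by move=> /dvdn_kron_dim /dvdn_leq ->.
have tag_gt0 A : A \in s -> (0 < tag A)%N by move=> /dvdn_kron_dim/dvdn_gt0 ->.
pose good A := `[< fam A >] && (0 < tag A)%N.
(* All levels below [j0] merge into colour 0, so the colours strictly between 0 and [j0] are
   empty. *)
pose col (A : sqmx F) := if (level (tag A) < j0)%N then 0%N else level (tag A).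
pose eta := c2 / ((2 ^ J)%:R * J.+1%:R).
have pos : 0 < (2 ^ J)%:R * J.+1%:R :> R by rewrite mulr_gt0 // ltr0n expn_gt0.
have eta_ge0 : 0 <= eta by rewrite ltW // divr_gt0.
pose x : R := n%:R `^ (eps / J.+1%:R).
have x_ge1 : 1 <= x by rewrite natr_powR_ge1 // divr_ge0 // ltW.
have classes ci : (ci < J.+1)%N ->
    nonrigid (kron_map (select (fun A => good A && (col A == ci))) s) eta
      ((\prod_(A <- s | good A && (col A == ci)) (tag A)%:R `^ (3 * eps)) * x).
  move=> ciJ; have [ci_small|ci_large] := ltnP ci j0; last first.
    have [ci_gt0 ci1 cib _ _] := j0E _ ci_large.
    have lvP A : good A && (col A == ci) -> level (tag A) = ci.
      by case/andP=> _ /eqP; rewrite /col; case: ifP => // _ e; move: ci_gt0; rewrite -e.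
    apply: (@nonrigid_class_large _ _ _ _ eps c eta ci) => //; [exact: hc|exact: hj| |].
      move=> A PA; have lvA := lvP A PA; case/andP: PA => /andP[/asboolP fA A_gt0] _.
      have A_ge : (2 ^ (2 ^ ci) <= tag A)%N by rewrite -lvA level_leq // lvA.
      case: (hfam A fA) => [Ab|rA].
        (* This alternative is absurd: it would give 2^(2^ci) <= d <= jb <= ci. *)
        have : (tag A)%:R <= jb%:R :> R by apply: le_trans hjb.
        rewrite ler_nat => Ajb.
        have := leq_trans A_ge (leq_trans Ajb cib).
        rewrite leqNgt (leq_trans (ltn_expl ci (isT : 1 < 2)%N)) //.
        by rewrite ltnW // ltn_expl.
      have [Z rZ sZ] := rc_rigidityP (powR_ge0 _ _) rA.
      by exists Z => //; apply: le_trans rZ (dec _ _ ci1 A_ge).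
    by move=> m m1 hm; apply: hJa.
  case: (posnP ci) => [ci0|ci_gt0]; last first.
    apply: nonrigid_class_dense => //; first by lra.
      by move=> A /andP[/andP[]].
    rewrite big_pred0 // => A; apply/negP => /andP[_]; rewrite /col.
    case: ltnP => [_ /eqP e|h /eqP e]; first by move: ci_gt0; rewrite -e.
    by move: ci_small; rewrite -e ltnNge h.
  have tagB A : good A && (col A == ci) -> (tag A)%:R <= B.
    case/andP=> _; rewrite ci0 /col; case: ltnP => [h _|h /eqP e].
      by rewrite ler_nat ltnW // (leq_trans (level_ltn _)) // !leq_exp2l.
    by move: h; rewrite e leqNgt j0_gt0.
  apply: (@nonrigid_class_small _ _ _ _ eps B kappa) => //.
  - by move=> A PA; split; [case/andP: PA => /andP[]|exact: tagB].
  - by apply: hsmall => // A /negPf nP; rewrite /select nP.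
  set k := count _ s => hk.
  have k_ge1 : 1 <= k%:R :> R.
    rewrite ler1n lt0n; apply/negP => /eqP k0; move: hk; rewrite k0 !mul0r.
    by apply/negP; rewrite -ltNge !mulr_gt0 // ltr0n expn_gt0.
  have := hJb J 1%N JJb isT k%:R k_ge1.
  rewrite expr1n mulr1 expn1 => h.
  have {}h : expR (- kappa * k%:R) <= c2 / 4 / ((2 ^ J)%:R * J.+1%:R).
    apply: h; have -> : c3 * (2 ^ J)%:R = 2 * (eps * (2 ^ J)%:R * ln 2) / ln B.
      by rewrite /c3; field; rewrite gt_eqF.
    rewrite ler_pdivrMr //; lra.
  have -> : eta = 4 * (c2 / 4 / ((2 ^ J)%:R * J.+1%:R)).
    by rewrite /eta; move: pos; set p := _ * _ => p_gt0; field; rewrite gt_eqF.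
  by rewrite ler_pM2l.
have col_lt A : A \in s -> good A && (col A < J.+1)%N.
  move=> As; rewrite /good tag_gt0 // andbT; apply/andP; split.
    by apply/asboolP; exact: sfam.
  by rewrite /col ltnS; case: ifP => // _; exact: leq_level (tag_le A As).
have := nonrigid_kron_colours classes.
have -> : kron_map (select (fun A => good A && (col A < J.+1)%N)) s =
    kron_map (fun A => tagged A) s.
  by apply: eq_kron_map => A /col_lt h; rewrite /select h.
have -> : \prod_(A <- s | good A && (col A < J.+1)%N) (tag A)%:R `^ (3 * eps) =
    n%:R `^ (3 * eps) :> R.
  rewrite -prodr_tag_powR big_seq_cond [RHS]big_seq_cond; apply: eq_bigl => A.
  by case: (boolP (A \in s)) => // /col_lt ->.
(* The total exponent is thus [3 * eps + eps], within [6 * eps]. *)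
have -> : x ^+ J.+1 = n%:R `^ eps.
  by rewrite -powR_mulrn ?powR_ge0 // -powRrM divfK // pnatr_eq0.
have nR : 0 < n%:R :> R by rewrite ltr0n.
case=> Z rZ sZ; apply: rc_rigidity_le; last exact: powR_ge0.
exists Z; last first.
  apply: sparse_le sZ; rewrite -powRD ?(gt_eqF nR) ?implybT //.
  by rewrite ler_powR ?ler1n //; lra.
apply: le_trans rZ _; rewrite mulrC ler_pM2l // /logb invf_div.
have -> : J.+1%:R * eta = ln a / (2 * (2 ^ J)%:R * ln 2).
  have : 0 < (2 ^ J)%:R :> R by rewrite ltr0n expn_gt0.
  have : 0 < J.+1%:R :> R by rewrite ltr0n.
  rewrite /eta /c2; move: J.+1%:R (2 ^ J)%:R => p q p_gt0 q_gt0.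
  by field; rewrite !gt_eqF.
have n_gt1 : (1 < n)%N.
  by apply: leq_trans n_gt; rewrite ltnS expn_gt0.
have ln_n : 0 < ln (n%:R : R) by rewrite ln_gt0 // ltr1n.
rewrite ler_pM2l // lef_pV2 ?posrE // ?mulr_gt0 // ?ltr0n ?expn_gt0 //.
have -> : 2 * (2 ^ J)%:R * ln 2 = ln (2 ^ (2 ^ J.+1))%:R :> R.
  by rewrite ln_natrX2 expnS natrM.
by rewrite ler_ln ?posrE // ?ltr0n ?expn_gt0 // ler_nat ltnW // level_ltn.
Qed.

End Assembly.

Theorem theorem1p10 (R : realType) (a : R) (a_gt1 : 1 < a) :
  exists N : R -> R -> nat,
  forall (eps b : R), 0 < eps -> eps < 1 / 2 -> 2 <= b ->
  forall (F : fieldType) (fam : sqmx F -> Prop),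
  (forall A : sqmx F, fam A ->
     (tag A)%:R <= b \/
     (rc_rigidity (tagged A)
        (Num.truncn ((tag A)%:R `^ (1 - rig_gamma a eps (tag A)))))%:R
       <= (tag A)%:R `^ eps) ->
  forall (k : nat) (Ms : 'I_k -> sqmx F), (forall i, fam (Ms i)) ->
  let M := \big[@kron F/kron1 F]_(i < k) Ms i in
  let n := tag M in
  (rc_rigidity (tagged M) (Num.truncn (n%:R / logb a n%:R)))%:R
    <= n%:R `^ (6 * eps) \/
  (n <= N b eps)%N.
Proof.
(* With the range conditions placed under the existential, every pair has a bound, 0 outside the
   range, and choice turns these into a function. *)
have bound (p : R * R) : exists N : nat, 0 < p.2 -> p.2 < 1 / 2 -> 2 <= p.1 ->
    forall (F : fieldType) (fam : sqmx F -> Prop),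
    (forall A : sqmx F, fam A ->
       (tag A)%:R <= p.1 \/
       (rc_rigidity (tagged A)
          (Num.truncn ((tag A)%:R `^ (1 - rig_gamma a p.2 (tag A)))))%:R
         <= (tag A)%:R `^ p.2) ->
    forall s : seq (sqmx F), (forall A, A \in s -> fam A) ->
    let n := kron_dim s in
    (rc_rigidity (kron_map (fun A => tagged A) s)
       (Num.truncn (n%:R / logb a n%:R)))%:R <= n%:R `^ (6 * p.2) \/
    (n <= N)%N.
  have [h|nh] := pselect [/\ 0 < p.2, p.2 < 1 / 2 & 2 <= p.1].
    case: h => h1 h2 h3; have [N hN] := kron_rigidity_bound a_gt1 h1 h2 h3.
    by exists N.
  by exists 0%N => h1 h2 h3; case: nh.
have [N hN] := choice bound.
exists (fun b eps => N (b, eps)) => eps b h1 h2 h3 F fam hfam k Ms hMs.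
rewrite big_kronE; apply: (hN (b, eps) h1 h2 h3 F fam hfam).
by move=> A /mapP[i _ ->].
Qed.
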